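(* There exists an absolute constant $C\in\mathbb{N}$ such that for every $\eta>0$ there exists $n_0\in\mathbb{N}$ such that the following holds for all even $n\geq n_0$. Let $G$ be an abelian group of order $n$ with $G=\mathbb{Z}_{2^{\alpha_1}}\oplus\cdots\oplus\mathbb{Z}_{2^{\alpha_{r_1}}}\oplus\mathbb{Z}_2^{r_2}\oplus K$, where $r_1,r_2$ are non-negative integers, $\alpha_1\geq\cdots\geq\alpha_{r_1}\geq 2$, $K$ is an abelian group of odd order, and $r:=r_1+r_2\geq 1$. If $n/2^r\geq C$, then $$f^\star_{\max}(G)\geq \left(2^{2r-1}+2^{r+r_1-1}-2^{r+1}+2^{r_1}\right)2^{n/4}+\left(2^r-2^{r_1}-\eta\right)2^{n/4-2^{r-2}}.$$
   Context: For a finite abelian group $(G,+)$: a triple $x,y,z\in G$ with $x+y=z$ and $x,y,z$ pairwise distinct is a distinct Schur triple. A subset $S\subseteq G$ is distinct sum-free if it contains no distinct Schur triple, and a distinct sum-free set is maximal if it is not properly contained in another distinct sum-free subset of $G$. $f^\star_{\max}(G)$ denotes the number of maximal distinct sum-free subsets of $G$. *)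

(* Defs.v *)
From mathcomp Require Export all_boot all_order all_algebra all_fingroup.
From mathcomp Require Export reals exp.

Set Implicit Arguments.
Unset Strict Implicit.
Unset Printing Implicit Defensive.

Import GRing.Theory Num.Theory.
Local Open Scope ring_scope.

Definition distinct_schur_triple (G : finZmodType) (x y z : G) : bool :=
  [&& x + y == z, x != y, y != z & x != z].

Definition distinct_sum_free (G : finZmodType) (S : {set G}) : bool :=
  ~~ [exists x in S, exists y in S, exists z in S, distinct_schur_triple x y z].

Definition fstar_max (G : finZmodType) : nat :=
  #|[set S : {set G} | maxset (@distinct_sum_free G) S]|.

(* The external direct sum
   Z_{2^(alpha 0)} + ... + Z_{2^(alpha (r1 - 1))} + Z_2^r2 + K,
   as a finite group: the group law of 'Z_m and of K is their addition.
   'Z_m is the ring of integers mod max m 2, so it is Z_m for every m > 1. *)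
Definition direct_sum (r1 r2 : nat) (alpha : 'I_r1 -> nat) (K : finZmodType) :
    finGroupType :=
  ({dffun forall i : 'I_r1, 'Z_(2 ^ alpha i)%N}
    * {dffun forall _ : 'I_r2, 'Z_2} * K)%type.

(* Main.v *)
(** Let A be the complement of an index 2 subgroup H, and let s be an element of H
    with 2s = 0 (possibly s = 0). The Schur triples meeting {0, s} and A join x to
    -x, x + s and s - x, so they cut A into blocks {x, x + s, -x, s - x} which are
    cliques, and {0, s} together with a transversal I of the blocks is distinct
    sum-free and can only be enlarged by elements of H. Blocks have 4 or 2 elements
    when s <> 0, and 2 or (for x of order 2) 1 element when s = 0, which gives
    2^(n/4) transversals, or 2^(n/4 - |A[2]|/2) for s = 0.

    Exponentially few transversals are bad. If {0, s, h} together with I is still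
    sum-free, then along a set W of blocks that is independent for the translation by
    h, the part of I outside W forbids one of u, u + s for each u in W; shifting I
    by s on an arbitrary subfamily of the blocks in W thus yields pairwise distinct
    transversals. The same shifting argument bounds the transversals which are
    almost contained in the complement of another index 2 subgroup, so the good
    triples (A, s, I) give distinct maximal sets. Counting pairs (A, s) according to
    whether H contains the 2-torsion of G gives the coefficients of the theorem. *)

Require Import Defs.
From mathcomp Require Import zify lra ring cyclic.

Set Implicit Arguments.
Unset Strict Implicit.
Unset Printing Implicit Defensive.

Import Order.TTheory.
Import GRing.Theory Num.Theory.
Local Open Scope ring_scope.

(** * Complements of index 2 subgroups, and their partition into blocks *)

(* The complements of the index 2 subgroups. *)
Definition odd_coset (G : finZmodType) (A : {set G}) : bool :=
  (A != set0) && [forall x, forall y, (x + y \in A) == (x \in A) (+) (y \in A)].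

Definition tor2 (G : finZmodType) : {set G} := [set x | x + x == 0].

Definition block (G : finZmodType) (s x : G) : {set G} :=
  [set y | [|| y == x, y == x + s, y == - x | y == s - x]].

Definition blocks (G : finZmodType) (s : G) (W : {set G}) : {set {set G}} :=
  block s @: W.

Definition transv (G : finZmodType) (s : G) (A : {set G}) : {set {set G}} :=
  [set I | is_transversal I (blocks s A) A].

Lemma in_odd_coset (G : finZmodType) (A : {set G}) (oA : odd_coset A) (x y : G) :
  (x + y \in A) = (x \in A) (+) (y \in A).
Proof. by case/andP: oA => _ /forallP/(_ x)/forallP/(_ y)/eqP. Qed.

Lemma odd_coset0 (G : finZmodType) (A : {set G}) (oA : odd_coset A) : 0 \notin A.
Proof. by rewrite -[0]addr0 (in_odd_coset oA) addbb. Qed.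

Lemma odd_cosetN (G : finZmodType) (A : {set G}) (oA : odd_coset A) (x : G) :
  (- x \in A) = (x \in A).
Proof.
have := in_odd_coset oA x (- x); rewrite subrr (negbTE (odd_coset0 oA)).
by case: (x \in A); case: (- x \in A).
Qed.

Lemma in_tor2 (G : finZmodType) (s : G) : (s \in tor2 G) = (s + s == 0).
Proof. by rewrite inE. Qed.

Lemma tor2N (G : finZmodType) (s : G) : s \in tor2 G -> - s = s.
Proof. by rewrite inE addr_eq0 => /eqP {2}->. Qed.

Lemma block_refl (G : finZmodType) (s x : G) : x \in block s x.
Proof. by rewrite inE eqxx. Qed.

Lemma blockN (G : finZmodType) (s x : G) : s \in tor2 G -> block s (- x) = block s x.
Proof.
move=> s2; apply/setP => y; rewrite !inE opprK [- x + s]addrC [s + x]addrC.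
by case: (y == - x); case: (y == s - x); case: (y == x); case: (y == x + s).
Qed.

Lemma blockD (G : finZmodType) (s x : G) : s \in tor2 G -> block s (x + s) = block s x.
Proof.
move=> s2; have sN := tor2N s2; have := s2; rewrite in_tor2 => /eqP ss.
apply/setP => y; rewrite !inE opprD sN -addrA ss addr0 [- x + s]addrC addrA ss add0r.
by case: (y == - x); case: (y == s - x); case: (y == x); case: (y == x + s).
Qed.

Lemma block_eq (G : finZmodType) (s x y : G) : s \in tor2 G ->
  y \in block s x -> block s y = block s x.
Proof.
move=> s2; rewrite inE => /or4P[]/eqP-> //; rewrite ?blockD ?blockN //.
by rewrite addrC blockD ?blockN.
Qed.

Lemma block_sym (G : finZmodType) (s x y : G) : s \in tor2 G ->
  (y \in block s x) = (x \in block s y).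
Proof.
by move=> s2; apply/idP/idP => /(block_eq s2) E; rewrite E block_refl.
Qed.

Lemma block_closed (G : finZmodType) (s x : G) (W : {set G}) : s \in tor2 G ->
  x \in W -> (forall w, w \in W -> - w \in W) -> (forall w, w \in W -> w + s \in W) ->
  block s x \subset W.
Proof.
move=> s2 xW WN Ws; apply/subsetP => y; rewrite inE => /or4P[]/eqP-> //; auto.
by rewrite addrC; auto.
Qed.

Lemma partition_blocks (G : finZmodType) (s : G) (W : {set G}) : s \in tor2 G ->
  (forall w, w \in W -> block s w \subset W) -> partition (blocks s W) W.
Proof.
move=> s2 WK; apply/and3P; split.
- rewrite eqEsubset; apply/andP; split.
    by apply/bigcupsP => c /imsetP[w wW ->]; exact: WK.
  apply/subsetP => w wW; apply/bigcupP; exists (block s w); last exact: block_refl.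
  exact: imset_f.
- apply/trivIsetP => c d /imsetP[w wW ->] /imsetP[v vW ->].
  apply: contraR => /pred0Pn[y /andP[/= yw yv]].
  by rewrite -(block_eq s2 yw) -(block_eq s2 yv).
- by apply/imsetP => -[w _ E]; have := block_refl s w; rewrite -E inE.
Qed.

Lemma block_sub_odd_coset (G : finZmodType) (A : {set G}) (s : G) : odd_coset A ->
  s \in tor2 G :\: A -> forall x, x \in A -> block s x \subset A.
Proof.
move=> oA; rewrite inE => /andP[sA s2] x xA; apply: block_closed => // w wA.
  by rewrite odd_cosetN.
by rewrite (in_odd_coset oA) wA (negbTE sA).
Qed.

Lemma partition_odd_coset (G : finZmodType) (A : {set G}) (s : G) : odd_coset A ->
  s \in tor2 G :\: A -> partition (blocks s A) A.
Proof.
move=> oA sA; apply: partition_blocks; first by case/setDP: sA.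
exact: block_sub_odd_coset.
Qed.

(** * Counting and shifting transversals *)

(** A transversal is the image of exactly one choice function on the blocks, so the count is that of
    [pfamily]; [x0] is the value such a function takes off [P]. *)
Lemma card_transversals (T : finType) (x0 : T) (P : {set {set T}}) (D : {set T}) :
  partition P D -> #|[set X | is_transversal X P D]| = (\prod_(B in P) #|B|)%N.
Proof.
move=> partP; have tiP := partition_trivIset partP; have covP := cover_partition partP.
have -> : (\prod_(B in P) #|B| = #|pfamily x0 P (fun B : {set T} => mem B)|)%N.
  by rewrite card_pfamily foldrE big_image.
have fP (f : {ffun {set T} -> T}) (B C : {set T}) :
    f \in pfamily x0 P (fun B : {set T} => mem B) -> B \in P -> C \in P -> f B \in C -> B = C.
  move=> /pfamilyP[_ Ff] BP CP fBC.
  by rewrite -(def_pblock tiP BP (Ff _ BP)) (def_pblock tiP CP fBC).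
rewrite -(@card_in_imset _ _ (fun f : {ffun {set T} -> T} => [set f B | B in P])); last first.
  move=> f g Ff Fg E; apply/ffunP => B.
  have [/pfamilyP[sf Hf] /pfamilyP[sg Hg]] := (Ff, Fg).
  have [BP|BP] := boolP (B \in P); last first.
    have out (h : {ffun {set T} -> T}) : x0.-support h \subset P -> h B = x0.
      by move/subsetP/(_ B)/contraR => /(_ BP); move/eqP.
    by rewrite !out.
  have : f B \in [set g B | B in P] by rewrite -E imset_f.
  case/imsetP => C CP fBgC; rewrite fBgC; congr (g _).
  by symmetry; apply: (fP f) => //; rewrite fBgC; exact: Hg.
apply: eq_card => X; rewrite inE; apply/idP/imsetP => [trX|[f Ff ->]].
  exists [ffun B => if B \in P then transversal_repr x0 X B else x0].
    apply/pfamilyP; split=> [|B BP]; last by rewrite ffunE BP; exact: (repr_mem_pblock trX).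
    by apply/subsetP => B; rewrite inE ffunE; case: ifP => // _; rewrite eqxx.
  rewrite -{1}(im_transversal_repr trX x0); apply: eq_in_imset => B BP.
  by rewrite ffunE BP.
have /pfamilyP[_ Hf] := Ff.
rewrite /is_transversal partP /=; apply/andP; split.
  apply/subsetP => _ /imsetP[B BP ->]; rewrite -covP; apply/bigcupP; exists B => //.
  exact: Hf.
apply/forall_inP => B BP; apply/cards1P; exists (f B); apply/setP => y; rewrite !inE.
apply/andP/eqP => [[/imsetP[C CP ->] yB]|->]; last by split; [rewrite imset_f|exact: Hf].
by rewrite (fP f C B).
Qed.

Lemma transvP (G : finZmodType) (A : {set G}) (s : G) (I : {set G}) :
  odd_coset A -> s \in tor2 G :\: A ->
  reflect (I \subset A /\ forall x, x \in A -> exists u, I :&: block s x = [set u])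
    (I \in transv s A).
Proof.
move=> oA sA; rewrite inE /is_transversal (partition_odd_coset oA sA) /=.
apply: (iffP andP) => [[-> tr]|[-> tr]]; split=> //.
  move=> x xA; apply/cards1P; move/forall_inP: tr; apply; exact: imset_f.
by apply/forall_inP => _ /imsetP[x xA ->]; apply/cards1P; exact: tr.
Qed.

(* The elements forbidden by a transversal I are collected in D I; since D I only
   depends on the part of I outside W, it can be read off any shift of I on blocks of
   W, and an element of the shifted set lies in D I exactly when it was moved. *)
Lemma shift_bound (G : finZmodType) (A : {set G}) (s : G) (W : {set G})
    (B : {set {set G}}) (D : {set G} -> {set G}) :
  odd_coset A -> s \in tor2 G :\: A -> W \subset A ->
  (forall w, w \in W -> block s w \subset W) ->
  (forall I J, I :\: W = J :\: W -> D I = D J) ->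
  (forall I, I \in B -> I \in transv s A) ->
  (forall I u, I \in B -> u \in I -> u \in W -> u \notin D I /\ u + s \in D I) ->
  (#|B| * 2 ^ #|blocks s W| <= #|transv s A|)%N.
Proof.
move=> oA sA WA WK Dloc BT BD.
have s2 : s \in tor2 G by case/setDP: sA.
have ss : s + s = 0 by apply/eqP; rewrite -in_tor2.
(* Adding [s] on the blocks listed in [Z] preserves every block and is an involution, because 2s =
   0. The aim is to recover the pair [(I, Z)] from [flip Z @: I]. *)
pose flip (Z : {set {set G}}) x := if block s x \in Z then x + s else x.
have flip_block Z x : block s (flip Z x) = block s x.
  by rewrite /flip; case: ifP => // _; rewrite blockD.
have flipK Z : involutive (flip Z).
  move=> x; rewrite {1}/flip flip_block /flip; case: (block s x \in Z) => //.
  by rewrite -addrA ss addr0.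
have WZ (Z : {set {set G}}) x : Z \subset blocks s W -> block s x \in Z -> x \in W.
  move=> /subsetP sZ /sZ/imsetP[w wW E].
  by apply: (subsetP (WK w wW)); rewrite -E block_refl.
have flipW Z x : (flip Z x \in W) = (x \in W).
  apply/idP/idP => /WK/subsetP; apply; first by rewrite flip_block block_refl.
  by rewrite -(flip_block Z x) block_refl.
have trans I x : I \in B -> x \in A -> exists u, I :&: block s x = [set u].
  by move=> /BT/(transvP _ oA sA)[_]; apply.
have flip_cap Z I x u : I :&: block s x = [set u] ->
    (flip Z @: I) :&: block s x = [set flip Z u].
  move=> E; have : u \in [set u] by rewrite inE.
  rewrite -E => /setIP[uI ux]; apply/setP => y; rewrite !inE.
  have mem v : (flip Z v \in block s x) = (v \in block s x).
    by rewrite !(block_sym x) // ?flip_block.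
  apply/andP/eqP => [[/imsetP[v vI ->] vx]|->].
    congr (flip Z _); apply/set1P; rewrite -E inE vI -mem inE; exact: vx.
  by split; [rewrite imset_f | have := mem u; rewrite ux inE].
pose f (p : {set G} * {set {set G}}) : {set G} := flip p.2 @: p.1.
rewrite -card_powerset -cardsX -(@card_in_imset _ _ f); last first.
  move=> [I Z] [J Z']; rewrite !inE /= => /andP[IB sZ] /andP[JB sZ'] E.
  have out (K : {set G}) (Y : {set {set G}}) :
      Y \subset blocks s W -> K \in B -> K :\: W = (flip Y @: K) :\: W.
    move=> sY KB; apply/setP => y; rewrite !inE; apply/andP/andP => [][yW].
      move=> yK; split=> //; apply/imsetP; exists y => //.
      by rewrite /flip; case: ifP => // /(WZ _ _ sY); rewrite (negbTE yW).
    move=> /imsetP[v vK yv]; split=> //; move: yW vK; rewrite yv flipW /flip.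
    by case: ifP => // /(WZ _ _ sY) ->.
  have DE : D I = D J by apply: Dloc; rewrite (out I Z) // (out J Z') //; congr (_ :\: _).
  have inZ (K : {set G}) (Y : {set {set G}}) c :
      Y \subset blocks s W -> K \in B -> c \in blocks s W ->
      (c \in Y) = [exists y in (flip Y @: K) :&: c, y \in D K].
    move=> sY KB /imsetP[w wW ->]; have [u uE] := trans K w KB (subsetP WA w wW).
    have : u \in [set u] by rewrite inE.
    rewrite -uE => /setIP[uK uw]; have bu := block_eq s2 uw.
    have uW : u \in W by apply: (subsetP (WK _ wW)).
    have [uD usD] := BD K u KB uK uW.
    rewrite (flip_cap _ _ _ _ uE) -bu; apply/idP/exists_inP => [bY|[y /set1P->]].
      by exists (flip Y u); rewrite ?inE // /flip bY.
    by rewrite /flip; case: ifP => // _; rewrite (negbTE uD).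
  have EZ : Z = Z'.
    apply/setP => c; have [cW|cW] := boolP (c \in blocks s W).
      rewrite (inZ I Z) // (inZ J Z') // DE; move: E; rewrite /f /= => ->.
      by [].
    by apply/idP/idP => [/(subsetP sZ)|/(subsetP sZ')]; rewrite (negbTE cW).
  congr (_, _) => //; apply: (imset_inj (can_inj (flipK Z))).
  by rewrite {2}EZ.
apply/subset_leq_card/subsetP => _ /imsetP[[I Z] + ->].
rewrite !inE /= => /andP[IB sZ].
have /(transvP _ oA sA)[IA Itr] := BT _ IB.
suff: f (I, Z) \in transv s A by rewrite inE.
apply/(transvP _ oA sA); split=> [|x xA].
  apply/subsetP => _ /imsetP[v vI ->] /=; have vA := subsetP IA _ vI.
  apply: (subsetP (block_sub_odd_coset oA sA vA)).
  by rewrite -(flip_block Z) block_refl.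
by have [u uE] := Itr x xA; exists (flip Z u); exact: flip_cap.
Qed.

(** * Sizes of blocks, of families of transversals and of index 2 subgroups *)

Lemma card_block_le (G : finZmodType) (s x : G) : (#|block s x| <= 4)%N.
Proof.
have -> : block s x = [set x; x + s; - x; s - x].
  by apply/setP => y; rewrite !inE -!orbA.
by rewrite !cardsU !cards1; lia.
Qed.

Lemma leq_card_blocks (G : finZmodType) (s : G) (W : {set G}) :
  (#|W| <= 4 * #|blocks s W|)%N.
Proof.
have /subset_leq_card Wle : W \subset cover (blocks s W).
  apply/subsetP => w wW; apply/bigcupP; exists (block s w); last exact: block_refl.
  exact: imset_f.
apply: (leq_trans Wle); apply: (leq_trans (leq_of_leqif (leq_card_cover _))).
rewrite mulnC -sum_nat_const.
by apply: leq_sum => c /imsetP[w _ ->]; exact: card_block_le.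
Qed.

(** The block consists of the cosets of {0, s} through x and -x, which coincide or are disjoint. Its
    size m is thus 2 or 4, and both satisfy m^2 = 2^m; squaring keeps half-integral exponents out of
    [nat]. *)
Lemma card_block_sq (G : finZmodType) (s x : G) : s \in tor2 G -> s != 0 ->
  (#|block s x| ^ 2 = 2 ^ #|block s x|)%N.
Proof.
move=> s2 s0; have ss : s + s = 0 by apply/eqP; rewrite -in_tor2.
have xs (y : G) : y != y + s by rewrite -[X in X != _]addr0 (inj_eq (addrI y)) eq_sym.
have blockE : block s x = [set x; x + s] :|: [set - x; - x + s].
  by apply/setP => y; rewrite !inE -!orbA [- x + s]addrC.
have [N|N] := boolP (- x \in [set x; x + s]); rewrite blockE.
  have -> : [set - x; - x + s] = [set x; x + s].
    by case/set2P: N => ->; rewrite // -addrA ss addr0 setUC.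
  by rewrite setUid cards2 xs.
rewrite cardsU disjoint_setI0 ?cards0 ?cards2 ?xs ?subn0 //.
rewrite disjoint_sym disjoints_subset; apply/subsetP => y.
rewrite in_setC => /set2P[]-> //; apply: contra N => /set2P[] E; apply/set2P.
  by right; apply: (addIr s); rewrite E -addrA ss addr0.
by left; apply: (addIr s).
Qed.

(** A singleton block, which occurs when 2x = 0, violates m^2 = 2^m by a factor 2; the extra power
    on the left corrects this. *)
Lemma card_block0_sq (G : finZmodType) (x : G) :
  (#|block 0%R x| ^ 2 * 2 ^ #|block 0%R x :&: tor2 G| = 2 ^ #|block 0%R x|)%N.
Proof.
have -> : block 0 x = [set x; - x].
  by apply/setP => y; rewrite !inE addr0 add0r; case: (y == x); case: (y == - x).
have [x2|x2] := boolP (x \in tor2 G).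
  by rewrite (tor2N x2) setUid (setIidPl _) ?sub1set // cards1.
have -> : [set x; - x] :&: tor2 G = set0.
  apply/setP => y; rewrite !inE; apply/negbTE; apply: contra x2.
  move=> /andP[/orP[]/eqP-> //]; first by rewrite inE.
  by rewrite -opprD oppr_eq0 inE.
rewrite cards0 cards2; move: x2; rewrite inE addr_eq0 => ->.
by [].
Qed.

(** The local identity is multiplied over the blocks of [A]. The set [Z] unifies two cases: it will
    be empty for [s != 0] and the 2-torsion for [s = 0]. *)
Lemma card_transv_sq (G : finZmodType) (A Z : {set G}) (s : G) :
  odd_coset A -> s \in tor2 G :\: A ->
  (forall x, (#|block s x| ^ 2 * 2 ^ #|block s x :&: Z| = 2 ^ #|block s x|)%N) ->
  (#|transv s A| ^ 2 * 2 ^ #|A :&: Z| = 2 ^ #|A|)%N.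
Proof.
move=> oA sA H; have pA := partition_odd_coset oA sA.
have capE (c : {set G}) : (#|c :&: Z| = \sum_(x in c) (x \in Z))%N.
  rewrite -sum1_card (eq_bigl (fun x => (x \in c) && (x \in Z))) => [|x]; last by rewrite inE.
  by rewrite big_mkcondr; apply: eq_bigr => x _; case: (x \in Z).
rewrite (card_transversals 0 pA) (card_partition pA) expn_sum capE.
rewrite (set_partition_big _ pA) /= expn_sum -!mulnn -!big_split /=.
apply: eq_bigr => _ /imsetP[x _ ->]; rewrite -capE mulnn; exact: H.
Qed.

(** Translation by [a] maps each of the two parts injectively into the other. *)
Lemma card_half (G : finZmodType) (A U : {set G}) (a : G) : odd_coset A ->
  a \in A -> a \in U -> (forall x y, x \in U -> y \in U -> x + y \in U) ->
  (forall x, x \in U -> - x \in U) -> #|U :&: A| = #|U :\: A|.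
Proof.
move=> oA aA aU UD UN.
have im b (X Y : {set G}) : (forall x, x \in X -> x + b \in Y) -> (#|X| <= #|Y|)%N.
  move=> H; rewrite -(card_imset _ (@addIr _ b)); apply: subset_leq_card.
  by apply/subsetP => _ /imsetP[x /H xX ->].
apply/eqP; rewrite eqn_leq; apply/andP; split; apply: (im a) => x; rewrite !inE.
  by move=> /andP[xU xA]; rewrite UD // (in_odd_coset oA) xA aA.
by move=> /andP[xA xU]; rewrite UD // (in_odd_coset oA) (negbTE xA) aA.
Qed.

Lemma card_odd_coset (G : finZmodType) (A : {set G}) : odd_coset A ->
  (#|G| = 2 * #|A|)%N.
Proof.
move=> oA; have /andP[/set0Pn[a aA] _] := oA.
have E := @card_half G A setT a oA aA (in_setT _) (fun _ _ _ _ => in_setT _) (fun _ _ => in_setT _).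
by have := cardsID A [set: G]; rewrite -E setTI cardsT mul2n -addnn => <-.
Qed.

(** [A] cuts the index 2 subgroup [~: A'] into halves. *)
Lemma card_odd_cosetD (G : finZmodType) (A A' : {set G}) : odd_coset A ->
  odd_coset A' -> A != A' -> (#|G| = 4 * #|A :\: A'|)%N.
Proof.
move=> oA oA' AA'.
(* Inclusion of [A] in [A'] would force equality, both having half the size of [G]. *)
have [a aA aA'] : exists2 a, a \in A & a \notin A'.
  apply/subsetPn; apply: contra AA' => sub; rewrite eqEcard sub /=.
  by rewrite -(@leq_pmul2l 2) // -(card_odd_coset oA) -(card_odd_coset oA').
have := @card_half G A (~: A') a oA aA.
rewrite in_setC aA' => /(_ isT) H.
have {H} : #|~: A' :&: A| = #|~: A' :\: A|.
  apply: H => [x y|x]; rewrite !inE; last by rewrite odd_cosetN.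
  by rewrite (in_odd_coset oA') => /negbTE-> /negbTE->.
rewrite setIC -setDE => E; have := cardsID A (~: A'); rewrite -E setIC -setDE addnn.
have := cardsC A'; rewrite (card_odd_coset oA') mul2n -addnn => /addnI -> <-.
by rewrite -addnn !mulSn mul0n addn0 !addnA.
Qed.

(** * Sum-freeness, and exponential bounds on the bad transversals *)

Lemma distinct_sum_freeP (G : finZmodType) (S : {set G}) :
  reflect (forall x y z, x \in S -> y \in S -> z \in S -> x + y = z ->
             x != y -> y != z -> x != z -> False)
    (distinct_sum_free S).
Proof.
apply: (iffP idP) => [H x y z xS yS zS E xy yz xz|H].
  case/negP: H; apply/exists_inP; exists x => //; apply/exists_inP; exists y => //.
  by apply/exists_inP; exists z => //; rewrite /distinct_schur_triple E eqxx xy yz.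
apply/negP => /exists_inP[x xS /exists_inP[y yS /exists_inP[z zS /and4P[/eqP]]]].
exact: H.
Qed.

Lemma transv_capP (G : finZmodType) (A : {set G}) (s : G) (I : {set G}) (x : G) :
  odd_coset A -> s \in tor2 G :\: A -> I \in transv s A -> x \in A ->
  exists2 u, u \in I /\ u \in block s x & forall v, v \in I -> v \in block s x -> v = u.
Proof.
move=> oA sA /(transvP _ oA sA)[_ tr] /tr[u E]; exists u.
  by apply/setIP; rewrite E inE.
by move=> v vI vx; apply/set1P; rewrite -E inE vI.
Qed.

Definition halves (G : finZmodType) (c : G) : {set G} := [set y | y + y == c].

(** Solutions of y + y = c differ by 2-torsion, so subtracting a fixed one embeds them all in
    [tor2 G]. *)
Lemma card_halves_le (G : finZmodType) (c : G) :
  (#|halves c| <= #|tor2 G|)%N.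
Proof.
have [->|[y0]] := set_0Vmem (halves c); first by rewrite cards0.
rewrite inE => /eqP y0c; rewrite -(card_imset _ (@addIr _ (- y0))).
apply/subset_leq_card/subsetP => _ /imsetP[y + ->]; rewrite !inE => /eqP yc.
by rewrite addrACA yc -y0c -opprD subrr.
Qed.

(* W is a maximal union of blocks which is disjoint from its translates by h and -h;
   maximality makes W contain about a third of A. *)
Lemma extension_bound (G : finZmodType) (A : {set G}) (s h : G) (q : nat) :
  odd_coset A -> s \in tor2 G :\: A -> h \notin A -> h != 0 -> h != s ->
  (12 * q + 4 * #|tor2 G| <= #|A|)%N ->
  (#|[set I in transv s A | distinct_sum_free (h |: [set 0%R; s] :|: I)]| * 2 ^ q
    <= #|transv s A|)%N.
Proof.
move=> oA sA hA h0 hs qA.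
have [s2 sNA] : s \in tor2 G /\ s \notin A by case/setDP: sA.
have ss : s + s = 0 by apply/eqP; rewrite -in_tor2.
have sN := tor2N s2.
pose P (W : {set G}) :=
  (W \subset A) && [forall w in W, [&& - w \in W, w + s \in W & w + h \notin W]].
have /ex_maxset[W /maxsetP[/andP[WA /forall_inP WP] Wmax]] : exists W, P W.
  exists set0; rewrite /P sub0set /=; apply/forall_inP => w; by rewrite inE.
have WN w : w \in W -> - w \in W by case/WP/and3P.
have Ws w : w \in W -> w + s \in W by case/WP/and3P.
have Wh w : w \in W -> w + h \notin W by case/WP/and3P.
have WK w : w \in W -> block s w \subset W by move=> wW; apply: block_closed.
have WKe v w : v \in W -> w \in block s v -> w \in W by move=> /WK/subsetP; apply.
pose E := @halves G.
(* For y outside [W], [W + h] and [W - h], maximality forbids adding the block of y to [W]. The only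
   possible obstruction is a pair w, w + h inside that block, which forces 2y to be one of h, -h, h
   + s, -h + s. *)
have cover_A : A \subset W :|: [set w + h | w in W] :|: [set w - h | w in W]
    :|: (E h :|: E (h + s) :|: E (- h) :|: E (- h + s)).
  apply/subsetP => y yA; rewrite !in_setU; apply: contraT.
  rewrite !negb_or => /andP[/andP[/andP[yW yWh] yWh'] /andP[/andP[/andP[E1 E2] E3] E4]].
  have {}yWh : y - h \notin W.
    by apply: contra yWh => yh; apply/imsetP; exists (y - h); rewrite ?subrK.
  have {}yWh' : y + h \notin W.
    by apply: contra yWh' => yh; apply/imsetP; exists (y + h); rewrite ?addrK.
  have key w : w \in block s y -> (w + h \notin W) && (w + h \notin block s y).
    have mem v : v \in block s y -> w \in block s y -> w + h \in block s y ->
      [\/ w + h = w, w + h = w + s, w + h = - w | w + h = s - w].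
      move=> _ wy; rewrite -(block_eq s2 wy) inE => /or4P[]/eqP;
        by [constructor 1|constructor 2|constructor 3|constructor 4].
    have wwE : w \in block s y -> w + w = y + y \/ w + w = - (y + y).
      rewrite inE => /or4P[]/eqP ->; first by left.
      - by left; rewrite addrACA ss addr0.
      - by right; rewrite opprD.
      - by right; rewrite addrACA ss add0r opprD.
    move=> wy; apply/andP; split.
      have : w + h \in block s (y + h) \/ w + h \in block s (y - h).
        move: wy; rewrite inE => /or4P[]/eqP->.
        - by left; rewrite block_refl.
        - by left; rewrite inE addrAC eqxx orbT.
        - by right; rewrite inE opprB addrC eqxx !orbT.
        - by right; rewrite inE opprB addrAC -addrA eqxx !orbT.
      by case=> W1; apply/negP => /WKe; rewrite block_sym // in W1; move/(_ _ W1); apply/negP.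
    apply/negP => why; case: (mem w wy wy why) => /eqP.
    - by rewrite -subr_eq0 addrAC subrr add0r (negbTE h0).
    - by rewrite (inj_eq (addrI w)) (negbTE hs).
    - move=> /eqP wE; have {wE} wwh : w + w = - h.
        by rewrite -{1}[w]opprK -wE opprD addrAC addNr add0r.
      case: (wwE wy) => yE; move: wwh; rewrite yE.
        by move=> yh; move: E3; rewrite inE yh eqxx.
      by move/oppr_inj => yh; move: E1; rewrite inE yh eqxx.
    - move=> /eqP wE; have {wE} wwh : w + w = - h + s.
        by rewrite -[X in X + _](addrK h) wE addrAC addrNK addrC.
      case: (wwE wy) => yE; move: wwh; rewrite yE.
        by move=> yh; move: E4; rewrite inE yh eqxx.
      move/(congr1 -%R); rewrite opprK opprD opprK sN => yh.
      by move: E2; rewrite inE yh eqxx.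
  suff : P (W :|: block s y).
    move=> /Wmax/(_ (subsetUl _ _))/setP/(_ y).
    by rewrite in_setU block_refl orbT (negbTE yW).
  have yKA := block_sub_odd_coset oA sA yA.
  rewrite /P subUset WA yKA /=; apply/forall_inP => w /setUP[wW|wy].
    rewrite !in_setU (WN w wW) (Ws w wW) /= negb_or (Wh w wW) /=.
    (* A translate w + h of w in [W] cannot fall into the new block: that block also contains -(w +
       h), whose translate by [h] is -w, an element of [W]. *)
    apply/negP => why; have := key (w + h) why => /andP[_].
    have Nwhy : - (w + h) \in block s y.
      by rewrite block_sym // blockN // -block_sym.
    have := key _ Nwhy => /andP[+ _]; rewrite opprD addrNK.
    by rewrite (WN w wW).
  have /andP[k1 k2] := key w wy.
  rewrite !in_setU negb_or k1 k2 !andbT; apply/andP; split; apply/orP; right.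
    by rewrite block_sym // blockN // -block_sym.
  by rewrite block_sym // blockD // -block_sym.
have cardA : (#|A| <= 3 * #|W| + 4 * #|tor2 G|)%N.
  apply: (leq_trans (subset_leq_card cover_A)).
  have le1 := card_halves_le h; have le2 := card_halves_le (h + s).
  have le3 := card_halves_le (- h); have le4 := card_halves_le (- h + s).
  have i1 := leq_imset_card (fun w => w + h) (mem W).
  have i2 := leq_imset_card (fun w => w - h) (mem W).
  have U (X Y : {set G}) a b : (#|X| <= a -> #|Y| <= b -> #|X :|: Y| <= a + b)%N.
    by move=> Xa Yb; rewrite cardsU; apply: leq_trans (leq_subr _ _) _; apply: leq_add.
  rewrite !mulSn mul0n !addn0 !addnA -[(_ + _ + _ + _ + _)%N in leqRHS]addnA.
  have := U _ _ _ _ (U _ _ _ _ (U _ _ _ _ (leqnn #|W|) i1) i2)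
     (U _ _ _ _ (U _ _ _ _ (U _ _ _ _ le1 le2) le3) le4).
  by rewrite !addnA.
(* The factor 12 of the hypothesis is 3 * 4: up to 2-torsion terms [W] fills a third of [A], and a
   block has at most 4 elements. *)
have qW : (q <= #|blocks s W|)%N by have := leq_card_blocks s W; lia.
apply: leq_trans (leq_mul (leqnn _) (leq_pexp2l (isT : 0 < 2)%N qW)) _.
pose D I : {set G} := [set v | [exists x in I :\: W, (x + h == v) || (x + v == h)]].
apply: (@shift_bound G A s W _ D) => //.
- by move=> I J E1; rewrite /D E1.
- by move=> I; rewrite inE => /andP[].
move=> I u; rewrite inE => /andP[It /distinct_sum_freeP Idsf] uI uW.
have IA : I \subset A by case/(transvP _ oA sA): It.
have AhF (v : G) : v \in A -> v != h by move=> vA; apply: contraNneq hA => <-.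
have inS (v : G) : v \in I -> v \in h |: [set 0; s] :|: I by move=> vI; rewrite inE vI orbT.
have hS : h \in h |: [set 0; s] :|: I by rewrite !inE eqxx.
have no1 x : x \in I -> x + h != u.
  move=> xI; apply/eqP => xhu; apply: (Idsf x h u); rewrite ?(inS x) ?(inS u) //.
  - by rewrite AhF // (subsetP IA).
  - by rewrite eq_sym AhF // (subsetP IA).
  - by rewrite -xhu -[X in X != _]addr0 (inj_eq (addrI x)) eq_sym.
(* Since [u] is in [W], taking [x] outside [W] ensures x != u, so that x + u = h would be a distinct
   triple. *)
have no2 x : x \in I -> x \notin W -> x + u != h.
  move=> xI xW; apply/eqP => xuh; apply: (Idsf x u h); rewrite ?(inS x) ?(inS u) //.
  - by apply: contraNneq xW => ->.
  - by rewrite AhF // (subsetP IA).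
  - by rewrite AhF // (subsetP IA).
split.
  rewrite inE; apply/negP => /exists_inP[x /setDP[xI xW]].
  by rewrite (negbTE (no1 x xI)) (negbTE (no2 x xI xW)).
(* The point [x] of [I] in the block of [u - h] lies outside [W], as otherwise u - h and u would
   both be in [W]. Each of its four possible positions puts [u] or [u + s] into [D I], and
   sum-freeness rules out [u]. *)
have uhA : u - h \in A.
  by rewrite (in_odd_coset oA) odd_cosetN // (negbTE hA) (subsetP WA).
have [x [xI xuh] _] := transv_capP oA sA It uhA.
have xW : x \notin W.
  apply/negP => /WKe; rewrite block_sym // in xuh; move=> /(_ _ xuh) /Wh.
  by rewrite subrK uW.
rewrite inE; apply/exists_inP; exists x; first by rewrite inE xW.
move: xuh; rewrite inE => /or4P[]/eqP xE.
- by have := no1 x xI; rewrite xE subrK eqxx.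
- by rewrite xE addrAC subrK eqxx.
- by have := no2 x xI xW; rewrite xE opprB subrK eqxx.
- by rewrite xE opprB [u + s]addrC addrACA ss add0r subrK eqxx orbT.
Qed.

(** Shifting works with the constant forbidden set [~: A'] when s is in [A'], since translation by s
    then leaves [A']. If s is not in [A'], no block straddles [A'], so every block meeting
    [A :\: A'] has s' as its representative; then [A :\: A'] lies in one block, which is too small
    to be a quarter of [G]. *)
Lemma overlap_bound (G : finZmodType) (A A' : {set G}) (s s' : G) (q : nat) :
  odd_coset A -> odd_coset A' -> A != A' -> s \in tor2 G :\: A ->
  (4 * q + 4 <= #|A|)%N -> (16 < #|G|)%N ->
  (#|[set I in transv s A | I :\: A' \subset [set s']]| * 2 ^ q <= #|transv s A|)%N.
Proof.
move=> oA oA' AA' sA qA cG.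
have [s2 sNA] : s \in tor2 G /\ s \notin A by case/setDP: sA.
have ss : s + s = 0 by apply/eqP; rewrite -in_tor2.
pose W := A :\: block s s'.
have WA : W \subset A by exact: subsetDl.
have WK w : w \in W -> block s w \subset W.
  case/setDP => wA ws'; apply/subsetP => v vw; rewrite inE.
  rewrite (subsetP (block_sub_odd_coset oA sA wA) v vw) andbT.
  by apply: contra ws' => /(block_eq s2) <-; rewrite -block_sym.
have qW : (q <= #|blocks s W|)%N.
  have := leq_card_blocks s W; have := card_block_le s s'.
  have := cardsID (block s s') A; have := subset_leq_card (subsetIr A (block s s')).
  rewrite -/W; lia.
apply: leq_trans (leq_mul (leqnn _) (leq_pexp2l (isT : 0 < 2)%N qW)) _.
apply: (@shift_bound G A s W _ (fun=> ~: A')) => //.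
  by move=> I; rewrite inE => /andP[].
move=> I u; rewrite inE => /andP[It /subsetP Is'] uI uW.
have uA' : u \in A'.
  apply: contraLR uW => uA'; have /set1P -> : u \in [set s'] by apply: Is'; rewrite inE uA'.
  by rewrite inE block_refl.
rewrite in_setC uA'; split=> //; rewrite in_setC (in_odd_coset oA') uA' /=.
rewrite negbK; apply: contraT => sA'.
suff : (#|A :\: A'| <= 4)%N.
  by move: cG; rewrite (card_odd_cosetD oA oA' AA') (@ltn_pmul2l 4 4) // ltnNge => /negbTE ->.
apply: leq_trans (card_block_le s s'); apply/subset_leq_card/subsetP => w /setDP[wA wA'].
have [x [xI xw] _] := transv_capP oA sA It wA.
have xA' : x \notin A'.
  have : block s w \subset ~: A'.
    apply: block_closed => // [|v|v]; rewrite !inE ?odd_cosetN //.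
    by rewrite (in_odd_coset oA') (negbTE sA') => /negbTE->.
  by move/subsetP/(_ x xw); rewrite inE.
have /set1P <- : x \in [set s'] by apply: Is'; rewrite inE xA'.
by rewrite -block_sym.
Qed.

(** * Good transversals and the maximal sets they produce *)

(* If S is distinct sum-free and arises both from (A, s) and from (A', s'), then the
   only element of S outside A' and 0 is s'; such sets S are the excluded overlaps. *)
Definition good (G : finZmodType) (F : {set {set G}}) (s : G) (A : {set G}) :
    {set {set G}} :=
  [set I in transv s A |
     [forall h in ~: A :\: [set 0; s], ~~ distinct_sum_free (h |: [set 0; s] :|: I)] &&
     [forall A' in F :\ A, forall s' in tor2 G, ~~ (I :\: A' \subset [set s'])]].

(** By parity, a triple has zero or two members in [A]. Two members in [A] with sum or difference in
    {0, s} share a block, hence are equal in [I]; and {0, s} has no three distinct elements. *)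
Lemma transv_triple_free (G : finZmodType) (A : {set G}) (s : G) (I : {set G}) :
  odd_coset A -> s \in tor2 G :\: A -> I \in transv s A ->
  distinct_sum_free ([set 0; s] :|: I).
Proof.
move=> oA sA It; have [s2 sNA] : s \in tor2 G /\ s \notin A by case/setDP: sA.
have ss : s + s = 0 by apply/eqP; rewrite -in_tor2.
have sN := tor2N s2.
have IA x : x \in I -> x \in A by apply/subsetP; case/(transvP _ oA sA): It.
have uniq x y : x \in I -> y \in I -> y \in block s x -> x = y.
  move=> xI yI yx; have [u _ uE] := transv_capP oA sA It (IA x xI).
  by rewrite (uE y) // (uE x) // block_refl.
have TA x : x \in [set 0; s] -> x \notin A by case/set2P => -> //; exact: odd_coset0.
have add_block x t : t \in [set 0; s] -> x + t \in block s x.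
  by case/set2P => ->; rewrite !inE ?addr0 ?eqxx ?orbT.
have sub_block x t : t \in [set 0; s] -> t - x \in block s x.
  by case/set2P => ->; rewrite !inE ?sub0r ?eqxx ?orbT.
apply/distinct_sum_freeP => x y z /setUP[xT|xI] /setUP[yT|yI] /setUP[zT|zI] E xy yz xz.
- move: xT yT zT xy yz xz; rewrite !inE.
  by case/orP=> /eqP->; case/orP=> /eqP->; case/orP=> /eqP->; rewrite ?eqxx.
- by have := IA _ zI; rewrite -E (in_odd_coset oA) (negbTE (TA _ xT)) (negbTE (TA _ yT)).
- by have := TA _ zT; rewrite -E (in_odd_coset oA) (negbTE (TA _ xT)) IA.
- case/eqP: yz; apply: uniq => //; rewrite -E addrC; exact: add_block.
- by have := TA _ zT; rewrite -E (in_odd_coset oA) (negbTE (TA _ yT)) IA.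
- case/eqP: xz; apply: uniq => //; rewrite -E; exact: add_block.
- by case/eqP: xy; apply: uniq => //; rewrite -(addKr x y) E addrC; exact: sub_block.
- by have := IA _ zI; rewrite -E (in_odd_coset oA) !IA.
Qed.

(** An element of [A] outside [I] forms a triple with the representative of its block and one of 0,
    s. An element outside [A] is excluded by the first clause of [good]. *)
Lemma good_maxset (G : finZmodType) (F : {set {set G}}) (A : {set G}) (s : G) (I : {set G}) :
  odd_coset A -> s \in tor2 G :\: A -> I \in good F s A ->
  maxset (@distinct_sum_free G) ([set 0; s] :|: I).
Proof.
move=> oA sA; rewrite inE => /andP[It /andP[/forall_inP noh _]].
have [s2 sNA] : s \in tor2 G /\ s \notin A by case/setDP: sA.
have ss : s + s = 0 by apply/eqP; rewrite -in_tor2.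
have sN := tor2N s2.
apply/maxsetP; split=> [|S Sdsf sub]; first exact: (transv_triple_free oA sA It).
apply/eqP; rewrite eqEsubset sub andbT; apply/subsetP => x xS.
have /distinct_sum_freeP free := Sdsf.
have [xT|xT] := boolP (x \in [set 0; s]); first by rewrite inE xT.
have inS v : v \in I -> v \in S by move=> vI; apply: (subsetP sub); rewrite inE vI orbT.
have oS : 0 \in S by apply: (subsetP sub); rewrite !inE eqxx.
have sS : s \in S by apply: (subsetP sub); rewrite !inE eqxx orbT.
have [xA|xA] := boolP (x \in A); last first.
  have xh : x \in ~: A :\: [set 0; s] by rewrite !inE xA andbT; rewrite !inE in xT.
  have /negP[] := noh x xh; apply/distinct_sum_freeP => a b c aS bS cS; apply: free.
  - by move: aS; rewrite -setUA => /setU1P[->//|]; apply: (subsetP sub).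
  - by move: bS; rewrite -setUA => /setU1P[->//|]; apply: (subsetP sub).
  - by move: cS; rewrite -setUA => /setU1P[->//|]; apply: (subsetP sub).
have [u [uI ux] _] := transv_capP oA sA It xA.
have uA : u \in A by case/(transvP _ oA sA): It => /subsetP IA _; exact: IA.
rewrite inE; apply/orP; right; case: (eqVneq u x) => [<- //|unx].
have n0 v : v \in A -> v != 0 by apply: contraTneq => ->; exact: odd_coset0.
have ns v : v \in A -> v != s by apply: contraTneq => ->.
have uS := inS _ uI; exfalso.
move: ux; rewrite inE => /or4P[]/eqP uE; first by rewrite uE eqxx in unx.
- by apply: (free x s u) => //; rewrite ?ns // 1?eq_sym ?ns // eq_sym.
- apply: (free x u 0) => //; rewrite ?n0 //; last by rewrite eq_sym.
  by rewrite uE subrr.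
- apply: (free x u s) => //; rewrite ?ns //; last by rewrite eq_sym.
  by rewrite uE addrC subrK.
Qed.

Lemma leq_card_bigcup (I T : finType) (P : pred I) (f : I -> {set T}) :
  (#|\bigcup_(i | P i) f i| <= \sum_(i | P i) #|f i|)%N.
Proof.
elim/big_rec2: _ => [|i n X _ IH]; first by rewrite cards0.
by rewrite cardsU; apply: leq_trans (leq_subr _ _) _; rewrite leq_add2l.
Qed.

(** A union bound: there are at most [#|G|] choices of an extending h and [#|F| * #|tor2 G|] choices
    of an overlap (A', s'), each spoiling at most a fraction 1 / 2^q of the transversals. *)
Lemma transv_le_good (G : finZmodType) (F : {set {set G}}) (A : {set G}) (s : G) (q : nat) :
  (forall A', A' \in F -> odd_coset A') -> odd_coset A -> s \in tor2 G :\: A ->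
  (12 * q + 4 * #|tor2 G| <= #|A|)%N -> (4 * q + 4 <= #|A|)%N -> (16 < #|G|)%N ->
  (#|transv s A| * 2 ^ q <=
     #|good F s A| * 2 ^ q + (#|G| + #|F| * #|tor2 G|) * #|transv s A|)%N.
Proof.
move=> oF oA sA q1 q2 cG.
pose ext h := [set I in transv s A | distinct_sum_free (h |: [set 0; s] :|: I)].
pose ovl A' s' := [set I in transv s A | I :\: A' \subset [set s']].
pose X := \bigcup_(h in ~: A :\: [set 0; s]) ext h.
pose Y := \bigcup_(A' in F :\ A) \bigcup_(s' in tor2 G) ovl A' s'.
have sub : transv s A \subset good F s A :|: (X :|: Y).
  apply/subsetP => I It; rewrite in_setU [X in X || _]inE It /=.
  rewrite -implyNb; apply/implyP; rewrite negb_and => /orP[]; rewrite negb_forall_in.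
    move=> /exists_inP[h hA]; rewrite negbK => hI; rewrite inE; apply/orP; left.
    by apply/bigcupP; exists h => //; rewrite inE It.
  move=> /exists_inP[A' A'F]; rewrite negb_forall_in => /exists_inP[s' s2].
  rewrite negbK => hI; rewrite inE; apply/orP; right.
  by apply/bigcupP; exists A' => //; apply/bigcupP; exists s' => //; rewrite inE It.
have cX : (#|X| * 2 ^ q <= #|G| * #|transv s A|)%N.
  apply: leq_trans (leq_mul (leq_card_bigcup _ _) (leqnn _)) _.
  apply: (@leq_trans (\sum_(h in ~: A :\: [set 0%R; s]) #|transv s A|)%N).
    rewrite big_distrl; apply: leq_sum => h; rewrite !inE negb_or => /andP[/andP[h0 hs] hA].
    exact: extension_bound.
  by rewrite sum_nat_const leq_mul2r max_card orbT.
have cY : (#|Y| * 2 ^ q <= #|F| * #|tor2 G| * #|transv s A|)%N.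
  apply: leq_trans (leq_mul (leq_card_bigcup _ _) (leqnn _)) _.
  apply: (@leq_trans (\sum_(A' in F :\ A) #|tor2 G| * #|transv s A|)%N).
    rewrite big_distrl; apply: leq_sum => A' /setD1P[AA' A'F].
    apply: leq_trans (leq_mul (leq_card_bigcup _ _) (leqnn _)) _.
    rewrite -sum_nat_const big_distrl; apply: leq_sum => s' _.
    by apply: overlap_bound => //; [exact: oF | rewrite eq_sym].
  rewrite sum_nat_const mulnA leq_mul2r; apply/orP; right.
  by rewrite leq_mul2r; apply/orP; right; apply: subset_leq_card; exact: subsetDl.
have := subset_leq_card sub.
have cU (U V : {set {set G}}) : (#|U :|: V| <= #|U| + #|V|)%N by rewrite cardsU leq_subr.
have := cU (good F s A) (X :|: Y); have := cU X Y.
move: (2 ^ q)%N cX cY => Q; nia.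
Qed.

(** The triple (A, s, I) is recovered from S = {0, s} U I: once [A] is known, I is the part of S in
    [A] and {0, s} the rest. The second clause of [good] makes [A] unique. *)
Lemma sum_good_le (G : finZmodType) (F : {set {set G}}) :
  (forall A, A \in F -> odd_coset A) ->
  (\sum_(A in F) \sum_(s in tor2 G :\: A) #|good F s A| <= fstar_max G)%N.
Proof.
move=> oF.
pose X := [set p : {set G} * G * {set G} |
  [&& p.1.1 \in F, p.1.2 \in tor2 G :\: p.1.1 & p.2 \in good F p.1.2 p.1.1]].
pose f (p : {set G} * G * {set G}) : {set G} := [set 0; p.1.2] :|: p.2.
have -> : (\sum_(A in F) \sum_(s in tor2 G :\: A) #|good F s A| = #|X|)%N.
  rewrite -sum1_card (eq_bigl (fun p : {set G} * G * {set G} =>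
    ((p.1.1 \in F) && (p.1.2 \in tor2 G :\: p.1.1)) && (p.2 \in good F p.1.2 p.1.1)));
    last by move=> p; rewrite inE andbA.
  rewrite -(pair_big_dep (fun p : {set G} * G => (p.1 \in F) && (p.2 \in tor2 G :\: p.1))
    (fun p I => I \in good F p.2 p.1) (fun _ _ => 1%N)) /=.
  rewrite -(pair_big_dep (fun A : {set G} => A \in F) (fun A s => s \in tor2 G :\: A)
    (fun A s => \sum_(j in good F s A) 1)%N) /=.
  by apply: eq_bigr => A _; apply: eq_bigr => s _; rewrite sum1_card.
rewrite -(@card_in_imset _ _ f); last first.
  have cap (A : {set G}) s I : odd_coset A -> s \in tor2 G :\: A -> I \in good F s A ->
      (f (A, s, I) :\: A = [set 0; s]) /\ (f (A, s, I) :&: A = I).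
    move=> oA /[dup] sA /setDP[s2 sNA]; rewrite inE => /andP[It _].
    have [IA _] := transvP _ oA sA It.
    have T0 : [set 0; s] :&: A = set0.
      apply/setP => x; rewrite !inE; apply/negbTE/negP => /andP[/orP[]/eqP->].
        by apply/negP/odd_coset0.
      by apply/negP.
    rewrite /f /= setDUl setIUl T0 set0U (setIidPl IA); split=> //.
    have -> : I :\: A = set0 by apply/eqP; rewrite setD_eq0.
    by rewrite setU0; apply/setDidPl; rewrite -setI_eq0 T0.
  move=> [[A s] I] [[A' s'] I']; rewrite ![_ \in X]inE /=.
  move=> /and3P[AF sA Ig] /and3P[AF' sA' Ig'] E.
  have [E1 E2] := cap _ _ _ (oF _ AF) sA Ig.
  have [E1' E2'] := cap _ _ _ (oF _ AF') sA' Ig'.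
  have AA' : A = A'.
    (* Outside [A'] the set has only 0 and s'. As 0 is not in [I], the part of [I] outside [A'] is
       within {s'}, against goodness. *)
    apply/eqP; apply: contraT => AA'.
    move: Ig; rewrite inE => /andP[It /andP[_ /forall_inP/(_ A')]].
    rewrite !inE eq_sym AA' AF' => /(_ isT)/forall_inP/(_ s').
    case/setDP: sA' => s2' _ /(_ s2') /negP[].
    apply/subsetP => x /setDP[xI xA'].
    have : x \in [set 0; s'] by rewrite -E1' -E inE xA' /f /= inE xI orbT.
    case/set2P => xE; last by rewrite inE xE.
    have [IA _] := transvP _ (oF _ AF) sA It.
    by have := odd_coset0 (oF _ AF); rewrite -xE (subsetP IA x xI).
  rewrite -AA' in E1' E2' *; congr (_, _, _); last by rewrite -E2 -E2' E.
  have : [set 0; s] = [set 0; s'] by rewrite -E1 -E1' E.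
  move=> Es; have : s \in [set 0; s'] by rewrite -Es !inE eqxx orbT.
  case/set2P => // s0; have : s' \in [set 0; s] by rewrite Es !inE eqxx orbT.
  by case/set2P; rewrite s0.
apply/subset_leq_card/subsetP => _ /imsetP[[[A s] I] + ->].
rewrite [_ \in X]inE /= => /and3P[AF sA Ig]; rewrite inE.
exact: good_maxset (oF _ AF) sA Ig.
Qed.

(** * Parity coordinates and 2-torsion of the direct sum *)

Lemma odd_Zp_add (a : nat) (x y : 'Z_(2 ^ a)) : (0 < a)%N ->
  odd (x + y)%R = odd x (+) odd y.
Proof.
move=> a0; have d1 : (1 < 2 ^ a)%N by rewrite -(expn0 2) ltn_exp2l.
by rewrite /= odd_mod ?oddD // Zp_cast // oddX; case: (a) a0.
Qed.

Lemma Zp_halves (a : nat) (x : 'Z_(2 ^ a)) : (0 < a)%N ->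
  (x + x == 0) = (x == 0) || (x == inZp (2 ^ a.-1)).
Proof.
move=> a0; have d1 : (1 < 2 ^ a)%N by rewrite -(expn0 2) ltn_exp2l.
have dE : (2 ^ a = 2 * 2 ^ a.-1)%N by rewrite -expnS prednK.
have d0 : (0 < 2 ^ a.-1)%N by rewrite expn_gt0.
rewrite -!val_eqE /=; move: (nat_of_ord x) (ltn_ord x) => y; rewrite Zp_cast // => xlt.
have -> : (2 ^ a.-1 %% 2 ^ a = 2 ^ a.-1)%N by rewrite modn_small // dE; lia.
move: xlt; rewrite dE; move: (2 ^ a.-1)%N d0 => d d0 yd.
apply/eqP/orP => [H|[/eqP->|/eqP->]]; rewrite ?mod0n ?addnn -?mul2n ?modnn //.
have [yd'|dy] := ltnP (y + y) (2 * d); move: H.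
  by rewrite modn_small // => y0; left; apply/eqP; lia.
rewrite -[(y + y)%N](subnK dy) modnDr modn_small; last by lia.
by move=> H; right; apply/eqP; lia.
Qed.

(** The order of k divides both 2 and the odd number [#|K|]. *)
Lemma odd_card_halves (K : finZmodType) (k : K) : odd #|K| -> k + k = 0 -> k = 0.
Proof.
move=> oK kk; have k2 : (k ^+ 2 = 1)%g by [].
have kG : (#[k]%g %| #|[set: K]|)%N by apply: order_dvdG; rewrite inE.
have k2' : (#[k]%g %| 2)%N by rewrite order_dvdn k2.
have /eqP : #[k]%g == 1%N.
  rewrite -dvdn1 -(@Gauss_dvdr _ #|[set: K]|) ?muln1 //.
  by apply: (coprime_dvdl k2'); rewrite coprime2n cardsT.
by move/eqP; rewrite order_eq1 => /eqP.
Qed.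

Lemma direct_sum_mul1 (r1 r2 : nat) (alpha : 'I_r1 -> nat) (K : finZmodType)
  (x y : direct_sum r2 alpha K) (i : 'I_r1) : (x * y)%g.1.1 i = x.1.1 i + y.1.1 i.
Proof. by case: x y => [[a b] c] [[a' b'] c'] /=; rewrite ffunE. Qed.

Lemma direct_sum_mul2 (r1 r2 : nat) (alpha : 'I_r1 -> nat) (K : finZmodType)
  (x y : direct_sum r2 alpha K) (i : 'I_r2) : (x * y)%g.1.2 i = x.1.2 i + y.1.2 i.
Proof. by case: x y => [[a b] c] [[a' b'] c'] /=; rewrite ffunE. Qed.

(** The 2-torsion element with support [b]: each selected cyclic summand contributes its unique
    element of order 2, and the component in [K] is 0. *)
Definition direct_sum_tor2 (r1 r2 : nat) (alpha : 'I_r1 -> nat) (K : finZmodType)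
    (b : {ffun 'I_r1 + 'I_r2 -> bool}) : direct_sum r2 alpha K :=
  ([ffun i => if b (inl i) then inZp (2 ^ (alpha i).-1) else 0],
   [ffun j => if b (inr j) then 1 else 0], 0).

Lemma direct_sum_eqP (r1 r2 : nat) (alpha : 'I_r1 -> nat) (K : finZmodType)
  (x y : direct_sum r2 alpha K) :
  (forall i, x.1.1 i = y.1.1 i) -> (forall i, x.1.2 i = y.1.2 i) -> x.2 = y.2 -> x = y.
Proof.
case: x y => [[a b] c] [[a' b'] c'] /= /ffunP-> H ->.
by congr (_, _, _); apply/ffunP.
Qed.

Lemma Z2_cases (z : 'Z_2) : z = if z == 0 then 0 else 1.
Proof. by case: z => [[|[|z]] Hz] //; apply/val_inj. Qed.

(** This extracts all that the counting needs from the decomposition: [p] consists of the parities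
    of the cyclic coordinates and [e] of the corresponding generators. The last two clauses separate
    summands of order at least 4 from those of order 2. *)
Lemma coordinates (G : finZmodType) (r1 r2 : nat) (alpha : 'I_r1 -> nat) (K : finZmodType) :
  (forall i, (2 <= alpha i)%N) -> odd #|K| ->
  [set: G] \isog [set: direct_sum r2 alpha K] ->
  exists (p : 'I_r1 + 'I_r2 -> G -> bool) (e : 'I_r1 + 'I_r2 -> G),
  [/\ forall j x y, p j (x + y) = p j x (+) p j y,
      forall j j', p j (e j') = (j == j'),
      #|tor2 G| = (2 ^ (r1 + r2))%N,
      forall i x, x \in tor2 G -> p (inl i) x = false
    & forall i, e (inr i) \in tor2 G].
Proof.
move=> a2 oK iso; have cardE := card_isog iso.
have a0 i : (0 < alpha i)%N by apply: leq_trans (a2 i).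
have [f injf _] := isogP iso.
have fM x y : f (x + y) = (f x * f y)%g by rewrite -morphM ?inE.
have fI : injective f by move=> x y; apply: (injmP injf); rewrite inE.
have [|g fK gK] := inj_card_bij fI; first by rewrite !cardsT in cardE; rewrite cardE.
have f0 : f 0 = 1%g by exact: (morph1 f).
have tor2E x : (x \in tor2 G) = ((f x * f x)%g == 1%g).
  by rewrite inE -(inj_eq fI) fM f0.
have sqE (y : direct_sum r2 alpha K) :
    reflect (exists b, y = direct_sum_tor2 alpha K b) ((y * y)%g == 1%g).
  apply: (iffP eqP) => [yy|[b ->]].
    exists [ffun j => match j with inl i => y.1.1 i != 0 | inr i => y.1.2 i != 0 end].
    apply: direct_sum_eqP => [i|i|] /=.
    - rewrite !ffunE; have := congr1 (fun z : direct_sum r2 alpha K => z.1.1 i) yy.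
      rewrite direct_sum_mul1 /= ffunE => /eqP; rewrite [1%g]/(0 : 'Z_(_)) Zp_halves //.
      by case: eqVneq => [->|_ /eqP].
    - by rewrite !ffunE {1}[y.1.2 i]Z2_cases; case: eqP.
    - apply: (odd_card_halves oK).
      by have := congr1 (fun z : direct_sum r2 alpha K => z.2) yy.
  apply: direct_sum_eqP => [i|i|]; rewrite ?direct_sum_mul1 ?direct_sum_mul2 /=.
  - rewrite !ffunE; case: ifP => _; last by rewrite addr0.
    by apply/eqP; rewrite [1%g]/(0 : 'Z_(_)) Zp_halves // eqxx orbT.
  - by rewrite !ffunE; case: ifP => _; apply/val_inj.
  - exact: addr0.
exists (fun j x => match j with inl i => odd ((f x).1.1 i) | inr i => odd ((f x).1.2 i) end).
exists (fun j => g (match j with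
  | inl i => ([ffun i' => if i' == i then 1 else 0], [ffun _ => 0], 0)
  | inr i => ([ffun i' => 0], [ffun i' => if i' == i then 1 else 0], 0) end)).
split.
- move=> [i|i] x y; rewrite fM ?direct_sum_mul1 ?direct_sum_mul2.
    exact: odd_Zp_add.
  exact: (@odd_Zp_add 1).
- move=> [i|i] [i'|i']; rewrite gK /= ffunE //.
    by rewrite -[RHS]/(i == i'); case: (i == i').
  by rewrite -[RHS]/(i == i'); case: (i == i').
- have -> : tor2 G = [set g (direct_sum_tor2 alpha K b) | b : {ffun 'I_r1 + 'I_r2 -> bool}].
    apply/setP => x; rewrite tor2E; apply/sqE/imsetP => [[b E]|[b _ ->]].
      by exists b => //; rewrite -E fK.
    by exists b; rewrite gK.
  rewrite card_imset ?card_ffun ?card_bool ?card_sum ?card_ord //.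
  apply: inj_comp (can_inj gK) _ => b b' E; apply/ffunP => -[i|i].
    have := congr1 (fun z : direct_sum r2 alpha K => z.1.1 i) E; rewrite /= !ffunE.
    have nz : inZp (2 ^ (alpha i).-1) != 0 :> 'Z_(2 ^ alpha i).
      have d1 : (1 < 2 ^ alpha i)%N by rewrite -(expn0 2) ltn_exp2l.
      rewrite -val_eqE /= Zp_cast // modn_small; last by rewrite ltn_exp2l // ltn_predL.
      by rewrite expn_eq0.
    by case: (b _) (b' _) => -[] // /eqP; rewrite ?(negbTE nz) // eq_sym (negbTE nz).
  have := congr1 (fun z : direct_sum r2 alpha K => z.1.2 i) E; rewrite /= !ffunE.
  by case: (b _) (b' _) => -[].
(* The element 2^(alpha i - 1) of order 2 is even exactly because [alpha i] is at least 2. *)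
- move=> i x; rewrite tor2E => /sqE[b ->]; rewrite /= ffunE; case: ifP => // _.
  have d1 : (1 < 2 ^ alpha i)%N by rewrite -(expn0 2) ltn_exp2l.
  rewrite /= Zp_cast // odd_mod ?oddX; first by case: (alpha i) (a2 i) => [|[|n]].
  by case: (alpha i) (a0 i).
- move=> i; rewrite tor2E gK; apply/sqE.
  exists [ffun j => j == inr i]; apply: direct_sum_eqP => // i'; rewrite /= !ffunE //.
Qed.

(** * Real estimates for the transversal counts and for the losses *)

Lemma powR_half_square (R : realType) (N z m : nat) : (N ^ 2 * 2 ^ z = 2 ^ m)%N ->
  N%:R = 2 `^ ((m%:R - z%:R) / 2) :> R.
Proof.
move=> H; apply/eqP; rewrite -(@eqrXn2 _ 2) ?powR_ge0 //; apply/eqP.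
have E : (N%:R ^+ 2 * 2 ^+ z = 2 ^+ m :> R) by rewrite -!natrX -natrM H.
rewrite -[RHS]powR_mulrn ?powR_ge0 // -powRrM -mulrA mulVf ?mulr1 ?pnatr_eq0 //.
rewrite powRD ?pnatr_eq0 ?implybT // powRN !powR_mulrn // -E mulfK //.
by rewrite expf_neq0 // pnatr_eq0.
Qed.

(** Put t = n %/ 384, so the right exponent is 8t. As 384 = 8 * 48, the bound on [T] gives T / 4 <=
    2t + 2; the remaining factor 2^(6t) absorbs the polynomial and 1 / eta. *)
Lemma poly_loss_small (R : realType) (eta : R) : 0 < eta ->
  exists n0 : nat, forall n T : nat, (n0 <= n)%N -> (48 * T <= n)%N ->
    2 * n%:R ^+ 4 * 2 `^ (T%:R / 4) <= eta * 2 ^+ (8 * (n %/ 384)).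
Proof.
move=> eta0; pose c : R := 8 * 384 ^+ 4.
have c0 : 0 < c by rewrite mulr_gt0 // exprn_gt0.
exists (384 * Num.bound (c / eta))%N => n T n0n Tn.
set t := (n %/ 384)%N.
have tb : (Num.bound (c / eta) <= t)%N by rewrite leq_divRL // mulnC.
have nt : (n <= 384 * (t + 1))%N by rewrite /t; lia.
have Tt : (T <= 8 * (t + 1))%N by lia.
pose u : R := (t + 1)%:R.
have u1 : 1 <= u by rewrite ler1n addn1.
have cu : c <= eta * u.
  have : c / eta < (Num.bound (c / eta))%:R by apply: archi_boundP; rewrite divr_ge0 // ltW.
  rewrite ltr_pdivrMr // => /ltW/le_trans; apply; rewrite mulrC ler_pM2l //.
  by rewrite ler_nat (leq_trans tb) // leq_addr.
have uexp : u <= 2 ^+ t by rewrite -natrX ler_nat addn1 ltn_expl.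
have nu : n%:R <= 384 * u by rewrite -natrM ler_nat.
have n4 : n%:R ^+ 4 <= 384 ^+ 4 * u ^+ 4.
  by rewrite -exprMn lerXn2r // ?nnegrE // mulr_ge0 // (le_trans _ u1).
have powT : 2 `^ (T%:R / 4) <= 4 * (2 ^+ t) ^+ 2 :> R.
  have -> : 4 * (2 ^+ t) ^+ 2 = 2 `^ (2 * t + 2)%:R :> R.
    by rewrite powR_mulrn // exprD -exprM mulnC mulrC; congr (_ * _); rewrite expr2; lra.
  rewrite ler_powR ?ler1n // ler_pdivrMr // -natrM ler_nat; lia.
have u0 : 0 <= u by apply: le_trans u1.
apply: (@le_trans _ _ (2 * (384 ^+ 4 * u ^+ 4) * (4 * (2 ^+ t) ^+ 2))).
  by rewrite ler_pM ?powR_ge0 ?mulr_ge0 ?exprn_ge0 // ler_pM2l.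
have -> : 2 * (384 ^+ 4 * u ^+ 4) * (4 * (2 ^+ t) ^+ 2) = c * u ^+ 4 * (2 ^+ t) ^+ 2.
  by rewrite /c; ring.
have -> : 2 ^+ (8 * t) = (2 ^+ t) ^+ 6 * (2 ^+ t) ^+ 2 :> R by rewrite -exprD -exprM mulnC.
rewrite mulrA ler_wpM2r ?exprn_ge0 //.
(* One factor [u] pays for the constant [c], by the choice of the threshold; then u^5 <= u^6 <=
   (2^t)^6. *)
apply: (@le_trans _ _ (eta * u ^+ 5)).
  by rewrite [u ^+ 5]exprS mulrA ler_wpM2r ?exprn_ge0.
rewrite ler_pM2l //; apply: (@le_trans _ _ (u ^+ 6)).
  by rewrite ler_weXn2l.
by rewrite lerXn2r // ?nnegrE // exprn_ge0.
Qed.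

Lemma card_transv_powR (R : realType) (G : finZmodType) (A Z : {set G}) (s : G) :
  odd_coset A -> s \in tor2 G :\: A ->
  (forall x, (#|block s x| ^ 2 * 2 ^ #|block s x :&: Z| = 2 ^ #|block s x|)%N) ->
  #|transv s A|%:R = 2 `^ (#|G|%:R / 4 - #|A :&: Z|%:R / 2) :> R.
Proof.
move=> oA sA H; rewrite (powR_half_square R (card_transv_sq oA sA H)).
by rewrite (card_odd_coset oA) natrM; congr (_ `^ _); lra.
Qed.

Lemma card_transv_neq0 (R : realType) (G : finZmodType) (A : {set G}) (s : G) :
  odd_coset A -> s \in tor2 G :\: A -> s != 0 ->
  #|transv s A|%:R = 2 `^ (#|G|%:R / 4) :> R.
Proof.
move=> oA sA s0; rewrite (@card_transv_powR R G A set0) ?setI0 ?cards0 ?mul0r ?subr0 // => x.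
by rewrite setI0 cards0 muln1 card_block_sq //; case/setDP: sA.
Qed.

Lemma card_transv_0 (R : realType) (G : finZmodType) (A : {set G}) :
  odd_coset A ->
  #|transv 0 A|%:R = 2 `^ (#|G|%:R / 4 - #|A :&: tor2 G|%:R / 2) :> R.
Proof.
move=> oA; apply: card_transv_powR => //; last exact: card_block0_sq.
by rewrite inE odd_coset0 // in_tor2 addr0 eqxx.
Qed.

Lemma card_transv_le (R : realType) (G : finZmodType) (A : {set G}) (s : G) :
  odd_coset A -> s \in tor2 G :\: A ->
  #|transv s A|%:R <= 2 `^ (#|G|%:R / 4) :> R.
Proof.
move=> oA sA; have [->|s0] := eqVneq s 0; last by rewrite (card_transv_neq0 R oA sA s0).
rewrite card_transv_0 // ler_powR ?ler1n // gerDl oppr_le0.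
by rewrite divr_ge0.
Qed.

Lemma good_ge (R : realType) (G : finZmodType) (F : {set {set G}}) (A : {set G}) (s : G) (q : nat) :
  (forall A', A' \in F -> odd_coset A') -> odd_coset A -> s \in tor2 G :\: A ->
  (12 * q + 4 * #|tor2 G| <= #|A|)%N -> (4 * q + 4 <= #|A|)%N -> (16 < #|G|)%N ->
  #|transv s A|%:R - 2 `^ (#|G|%:R / 4) * (#|G| + #|F| * #|tor2 G|)%:R / 2 ^+ q
    <= #|good F s A|%:R :> R.
Proof.
move=> oF oA sA q1 q2 cG; have := transv_le_good oF oA sA q1 q2 cG.
have := card_transv_le R oA sA; move: (_ `^ _) => X.
move: #|transv s A| #|good F s A| (#|G| + _)%N => N g M NX.
rewrite -(ler_nat R) natrD !natrM natrX => H.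
have p0 : 0 < 2 ^+ q :> R by rewrite exprn_gt0.
rewrite lerBlDr -(ler_pM2r p0) mulrDl mulfVK ?gt_eqF //.
by apply: (le_trans H); rewrite lerD2l mulrC ler_wpM2r.
Qed.

(** The term [s = 0] is split off, being the only one whose transversal count depends on the
    2-torsion in [A]. *)
Lemma sum_good_ge (R : realType) (G : finZmodType) (F : {set {set G}}) (A : {set G}) (q : nat) :
  (forall A', A' \in F -> odd_coset A') -> odd_coset A ->
  (12 * q + 4 * #|tor2 G| <= #|A|)%N -> (4 * q + 4 <= #|A|)%N -> (16 < #|G|)%N ->
  (#|tor2 G :\: A|%:R - 1) * 2 `^ (#|G|%:R / 4) + 2 `^ (#|G|%:R / 4 - #|A :&: tor2 G|%:R / 2)
    - #|tor2 G :\: A|%:R * (2 `^ (#|G|%:R / 4) * (#|G| + #|F| * #|tor2 G|)%:R / 2 ^+ q)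
  <= (\sum_(s in tor2 G :\: A) #|good F s A|)%:R :> R.
Proof.
move=> oF oA q1 q2 cG; set X := 2 `^ (#|G|%:R / 4); set L := X * _ / _.
have s0 : 0 \in tor2 G :\: A by rewrite inE odd_coset0 // in_tor2 addr0 eqxx.
rewrite natr_sum.
apply: (@le_trans _ _ (\sum_(s in tor2 G :\: A) (#|transv s A|%:R - L))); last first.
  by apply: ler_sum => s sA; apply: good_ge.
rewrite sumrB sumr_const -[L *+ _]mulr_natl lerD2r (bigD1 0) //= card_transv_0 //.
rewrite [leLHS]addrC lerD2l (eq_bigr (fun=> X)); last first.
  by move=> s /andP[sA sn0]; exact: card_transv_neq0.
rewrite sumr_const -[X *+ _]mulr_natl ler_wpM2r ?powR_ge0 //.
have -> : #|[pred s in tor2 G :\: A | s != 0]| = (#|tor2 G :\: A| - 1)%N.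
  rewrite (cardsD1 0 (tor2 G :\: A)) s0 addKn; apply: eq_card => s.
  by rewrite !inE andbC.
by rewrite natrB // card_gt0; apply/set0Pn; exists 0.
Qed.

(** * Odd cosets given by characters *)

(** The elements on which the character to Z_2 with coordinates [a] is nontrivial. *)
Definition char_set (G : finZmodType) (J : finType) (p : J -> G -> bool)
    (a : {ffun J -> bool}) : {set G} :=
  [set x | \big[addb/false]_(j | a j) p j x].

Lemma in_char_set_dual (G : finZmodType) (J : finType) (p : J -> G -> bool) (e : J -> G)
    (a : {ffun J -> bool}) (j : J) :
  (forall i i', p i (e i') = (i == i')) -> (e j \in char_set p a) = a j.
Proof.
move=> pe; rewrite inE (eq_bigr (fun i => i == j)) => [|i _]; last exact: pe.
have [aj|aj] := boolP (a j).
  by rewrite (bigD1 j) //= eqxx big1 // => i /andP[_ /negbTE].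
by rewrite big1 // => i ai; apply: contraNF aj => /eqP <-.
Qed.

Lemma char_set_inj (G : finZmodType) (J : finType) (p : J -> G -> bool) (e : J -> G) :
  (forall i i', p i (e i') = (i == i')) -> injective (char_set p).
Proof.
move=> pe a b E; apply/ffunP => j.
by rewrite -(in_char_set_dual a j pe) E in_char_set_dual.
Qed.

Lemma odd_coset_char_set (G : finZmodType) (J : finType) (p : J -> G -> bool) (e : J -> G)
    (a : {ffun J -> bool}) :
  (forall i x y, p i (x + y) = p i x (+) p i y) ->
  (forall i i', p i (e i') = (i == i')) -> a != [ffun=> false] ->
  odd_coset (char_set p a).
Proof.
move=> pM pe a0; apply/andP; split.
  have [j aj] : exists j, a j.
    apply/existsP; apply: contraNT a0; rewrite negb_exists => /forallP a0.
    by apply/eqP/ffunP => j; rewrite ffunE; apply/negbTE.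
  by apply/set0Pn; exists (e j); rewrite (in_char_set_dual a j pe).
apply/forallP => x; apply/forallP => y; rewrite !inE -big_split /=.
by apply/eqP/eq_bigr => i _; exact: pM.
Qed.

Lemma char_set_tor2 (G : finZmodType) (I1 I2 : finType) (p : I1 + I2 -> G -> bool)
    (a : {ffun I1 + I2 -> bool}) :
  (forall i x, x \in tor2 G -> p (inl i) x = false) -> (forall i, ~~ a (inr i)) ->
  char_set p a :&: tor2 G = set0.
Proof.
move=> p2 a2; apply/setP => x; rewrite inE [x \in char_set _ _]inE in_set0.
have [x2|//] := boolP (x \in tor2 G); last by rewrite andbF.
by rewrite andbT big1 // => -[i _|i]; [exact: p2 | rewrite (negbTE (a2 i))].
Qed.

Lemma card_char_set_tor2 (G : finZmodType) (A : {set G}) (x : G) :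
  odd_coset A -> x \in A -> x \in tor2 G ->
  #|tor2 G :\: A| = #|A :&: tor2 G| /\ #|tor2 G| = (2 * #|A :&: tor2 G|)%N.
Proof.
move=> oA xA x2; have E : #|tor2 G :&: A| = #|tor2 G :\: A|.
  apply: (card_half oA xA x2) => [y z|y]; rewrite !in_tor2 => /eqP y2.
    by move=> /eqP z2; rewrite addrACA y2 z2 addr0.
  by rewrite -opprD y2 oppr0.
rewrite [A :&: _]setIC; split; first by rewrite E.
by rewrite -(cardsID A (tor2 G)) -E addnn mul2n.
Qed.

Lemma card_ffun_inl (I1 I2 : finType) :
  #|[set a : {ffun I1 + I2 -> bool} | [forall i, ~~ a (inr i)]]| = (2 ^ #|I1|)%N.
Proof.
pose ext (b : {ffun I1 -> bool}) : {ffun I1 + I2 -> bool} :=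
  [ffun j => if j is inl i then b i else false].
have extI : injective ext.
  by move=> b b' /ffunP E; apply/ffunP => i; have := E (inl i); rewrite !ffunE.
rewrite -card_bool -card_ffun -(card_imset _ extI); apply: eq_card => a.
rewrite inE; apply/forallP/imsetP => [a2|[b _ -> i]]; last by rewrite ffunE.
exists [ffun i => a (inl i)] => //; apply/ffunP => -[i|i]; rewrite !ffunE //.
exact: negbTE.
Qed.

(** To be used with t = 2^r and b = 2^r1: [b - 1] nonzero characters are trivial on the 2-torsion
    and [t - b] are not. [L] is the loss per pair (A, s), and there are at most t^2 pairs. *)
Lemma weighted_total (R : realType) (b t X Y L eta : R) :
  0 <= L -> 0 <= b -> b <= t ->
  t ^+ 2 * L <= eta * Y ->
  (t * t / 2 + b * t / 2 - 2 * t + b) * X + (t - b - eta) * Y <=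
  (b - 1) * ((t - 1) * X + X - t * L) +
  (t - b) * ((t / 2 - 1) * X + Y - t / 2 * L).
Proof.
move=> L0 b0 bt H.
have H2 : ((b - 1) * t + (t - b) * (t / 2)) * L <= t ^+ 2 * L.
  rewrite ler_wpM2r // expr2; nra.
have -> : (b - 1) * ((t - 1) * X + X - t * L) + (t - b) * ((t / 2 - 1) * X + Y - t / 2 * L)
  = (t * t / 2 + b * t / 2 - 2 * t + b) * X + (t - b) * Y
    - ((b - 1) * t + (t - b) * (t / 2)) * L by field.
lra.
Qed.

(** * Choice of constants and summation over the nonzero characters *)

Theorem theorem5p2 :
  exists C : nat,
  forall (R : realType) (eta : R), 0 < eta ->
  exists n0 : nat,
  forall n : nat, ~~ odd n -> (n0 <= n)%N ->
  forall (G : finZmodType) (r1 r2 : nat) (alpha : 'I_r1 -> nat)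
         (K : finZmodType),
    #|G| = n ->
    (forall i j : 'I_r1, (i <= j)%N -> (alpha j <= alpha i)%N) ->
    (forall i : 'I_r1, (2 <= alpha i)%N) ->
    odd #|K| ->
    [set: G] \isog [set: direct_sum r2 alpha K] ->
    let r := (r1 + r2)%N in
    (1 <= r)%N ->
    C%:R <= n%:R / 2 ^+ r :> R ->
    (2 ^+ (2 * r - 1) + 2 ^+ (r + r1 - 1) - 2 ^+ (r + 1) + 2 ^+ r1)
        * 2 `^ (n%:R / 4)
      + (2 ^+ r - 2 ^+ r1 - eta) * 2 `^ (n%:R / 4 - 2 ^ (r%:Z - 2))
    <= (fstar_max G)%:R.
Proof.
(* With 48 * 2^r <= n and 48 * q <= n one gets 12 * q + 4 * 2^r <= n / 4 + n / 12, which is below n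
   / 2, the size of every odd coset. *)
exists 48%N => R eta eta0; have [n0 Hn0] := poly_loss_small eta0.
exists n0 => n _ nn0 G r1 r2 alpha K cG _ a2 oK iso r r_gt0 CT.
have [p [e [pM pe cT p_inl e_inr]]] := coordinates a2 oK iso.
rewrite -/r in cT.
have T0 : (0 < 2 ^ r)%N by rewrite expn_gt0.
have Tn : (48 * 2 ^ r <= n)%N.
  by move: CT; rewrite ler_pdivlMr ?exprn_gt0 // -natrX -natrM ler_nat.
set q := (8 * (n %/ 384))%N.
have qn : (48 * q <= n)%N by rewrite mulnA mulnC leq_trunc_div.
pose z : {ffun 'I_r1 + 'I_r2 -> bool} := [ffun=> false].
pose F := char_set p @: [set~ z].
have inj := char_set_inj pe.
have odd_char a : a != z -> odd_coset (char_set p a) by exact: odd_coset_char_set.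
have oF A : A \in F -> odd_coset A.
  by case/imsetP => a; rewrite !inE => /odd_char oA ->.
have cF : (#|F| <= 2 ^ r)%N.
  rewrite card_imset // -(_ : #|{ffun 'I_r1 + 'I_r2 -> bool}| = (2 ^ r)%N) ?max_card //.
  by rewrite card_ffun card_bool card_sum !card_ord.
pose X : R := 2 `^ (n%:R / 4).
pose t : R := 2 ^+ r.
pose Y : R := 2 `^ (n%:R / 4 - t / 4).
pose L : R := X * (n + #|F| * 2 ^ r)%:R / 2 ^+ q.
pose S1 := [set a : {ffun 'I_r1 + 'I_r2 -> bool} | [forall i, ~~ a (inr i)]].
(* [v1] serves the characters trivial on the 2-torsion, where [s = 0] counts as much as any other s;
   in [v2] half of the 2-torsion lies in [A] and [s = 0] contributes only [Y]. *)
pose v1 := (t - 1) * X + X - t * L.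
pose v2 := (t / 2 - 1) * X + Y - t / 2 * L.
have lower a : a != z ->
    (if a \in S1 then v1 else v2) <=
    (\sum_(s in tor2 G :\: char_set p a) #|good F s (char_set p a)|)%:R.
  move=> az; set A := char_set p a; have oA : odd_coset A by exact: odd_char.
  have cA := card_odd_coset oA; rewrite cG in cA.
  have := @sum_good_ge R G F A q oF oA; rewrite cT cG -/X -/L => lb.
  have [q1 q2 n16] : [/\ 12 * q + 4 * 2 ^ r <= #|A|, 4 * q + 4 <= #|A| & 16 < n]%N.
    by move: (2 ^ r)%N q #|A| T0 Tn qn cA {L v1 v2 lb} => T k m; split; lia.
  apply: le_trans (lb q1 q2 n16); case: ifP => [|/negbT]; rewrite inE.
    move=> /forallP aS; have A0 := char_set_tor2 p_inl aS.
    have -> : #|tor2 G :\: A| = (2 ^ r)%N.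
      by rewrite -cT -(cardsID A (tor2 G)) setIC A0 cards0.
    by rewrite A0 cards0 mul0r subr0 natrX.
  rewrite negb_forall => /existsP[j]; rewrite negbK => aj.
  have ejA : e (inr j) \in A by rewrite (in_char_set_dual a (inr j) pe).
  have [-> E] := card_char_set_tor2 oA ejA (e_inr j).
  have -> : #|A :&: tor2 G|%:R = t / 2 :> R.
    by rewrite /t -natrX -cT E natrM [2 * _]mulrC mulfK // pnatr_eq0.
  by have <- : t / 4 = t / 2 / 2 by field.
have total : \sum_(a in [set~ z]) (if a \in S1 then v1 else v2) <= (fstar_max G)%:R.
  apply: (@le_trans _ _ (\sum_(A in F) \sum_(s in tor2 G :\: A) #|good F s A|)%:R).
    rewrite big_imset /= => [|a b _ _]; last exact: inj.
    by rewrite natr_sum; apply: ler_sum => a; rewrite in_setC1 => /lower.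
  by rewrite ler_nat; exact: sum_good_le.
have zS1 : z \in S1 by rewrite inE; apply/forallP => i; rewrite ffunE.
have cS1 : #|S1| = (2 ^ r1)%N by rewrite card_ffun_inl card_ord.
have cAll : #|{: {ffun 'I_r1 + 'I_r2 -> bool}}| = (2 ^ r)%N.
  by rewrite card_ffun card_bool card_sum !card_ord.
apply: le_trans total.
rewrite (bigID (mem S1)) /=.
rewrite (eq_bigr (fun=> v1)) => [|a /andP[_ ->] //].
rewrite [X in _ <= _ + X](eq_bigr (fun=> v2)) => [|a /andP[_ /negbTE ->] //].
rewrite !sumr_const -[v1 *+ _]mulr_natl -[v2 *+ _]mulr_natl.
(* The 1 subtracted is for the zero function [z], which belongs to [S1] but gives no odd coset. *)
have -> : #|[pred a in [set~ z] | a \in S1]|%:R = 2 ^+ r1 - 1 :> R.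
  rewrite -natrX -cS1 (cardsD1 z S1) zS1 add1n -natr1 addrK; congr (_%:R).
  by apply: eq_card => a; rewrite !inE.
have -> : #|[pred a in [set~ z] | a \notin S1]|%:R = t - 2 ^+ r1 :> R.
  rewrite /t -!natrX -cAll -cS1 -(cardsC S1) natrD addrC addKr; congr (_%:R).
  apply: eq_card => a; rewrite !inE andbC; case: eqVneq => [->|_]; last by rewrite andbT.
  by rewrite andbF; move: zS1; rewrite inE => ->.
have t_gt0 : 0 < t by rewrite exprn_gt0.
(* The exponent r - 2 is an integer, negative when r = 1; in all cases 2^(r - 2) = t / 4. *)
have YE : 2 `^ (n%:R / 4 - 2 ^ (r%:Z - 2)) = Y.
  by rewrite /Y expfzDr ?pnatr_eq0 // /t; congr (_ `^ (_ - _ * _)); rewrite -exprnN expr2 -natrM.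
have -> : 2 ^+ (2 * r - 1) = t * t / 2 :> R.
  rewrite /t -exprD addnn -mul2n -[in RHS](subnK (_ : 1 <= 2 * r)%N) ?muln_gt0 //.
  by rewrite exprD mulfK ?pnatr_eq0.
have -> : 2 ^+ (r + r1 - 1) = 2 ^+ r1 * t / 2 :> R.
  rewrite /t -exprD addnC -[in RHS](subnK (leq_trans r_gt0 (leq_addl r1 r))).
  by rewrite exprD mulfK ?pnatr_eq0.
rewrite addn1 exprS YE -/X -/t.
apply: weighted_total.
- by rewrite divr_ge0 ?mulr_ge0 ?powR_ge0 ?exprn_ge0.
- by rewrite exprn_ge0.
- by rewrite ler_weXn2l ?ler1n // leq_addr.
have XE : X = Y * 2 `^ (t / 4).
  by rewrite /Y /X -powRD ?subrK // pnatr_eq0 implybT.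
have q0 : 0 < 2 ^+ q :> R by rewrite exprn_gt0.
have H := Hn0 n (2 ^ r)%N nn0 Tn; rewrite natrX -/t -/q in H.
have Tle : (2 ^ r <= n)%N by apply: leq_trans Tn; exact: leq_pmull.
have tn : t <= n%:R by rewrite /t -natrX ler_nat.
have M_le : (n + #|F| * 2 ^ r)%:R <= 2 * n%:R ^+ 2 :> R.
  rewrite -natrX -natrM ler_nat -mulnn.
  rewrite mul2n -addnn leq_add ?leq_pmulr ?(leq_trans T0) //.
  by apply: leq_mul; first exact: leq_trans Tle.
(* After cancelling [Y], the loss is at most n^2 * 2n^2 * 2^(t / 4), by t <= n and [M_le]; this is
   the quantity bounded by [poly_loss_small]. *)
rewrite /L mulrA ler_pdivrMr // XE.
have -> : t ^+ 2 * (Y * 2 `^ (t / 4) * (n + #|F| * 2 ^ r)%:R)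
  = Y * (t ^+ 2 * (n + #|F| * 2 ^ r)%:R * 2 `^ (t / 4)) by ring.
rewrite [eta * Y]mulrC -[leRHS]mulrA ler_wpM2l ?powR_ge0 //.
apply: le_trans H; rewrite ler_wpM2r ?powR_ge0 //.
have -> : 2 * n%:R ^+ 4 = n%:R ^+ 2 * (2 * n%:R ^+ 2) :> R by ring.
by rewrite ler_pM ?exprn_ge0 // lerXn2r // ?nnegrE // ltW.
Qed.
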